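(* Let $X\to B$ be a symplectic family of Lagrangian tori with dual family $\hat X$. Let $S\subset X$ be the image of a Lagrangian section of $f:X\to B$, and let $\mathfrak L=(\mathcal L,\nabla)$ be a $U(1)$ local system on $S$. Then: 1. the pair $(\mathcal L,\nabla)$ is WIT$_0$; 2. $\hat{\mathcal L}=\hat p_{S,*}\ker\nabla_r^{\mathcal L}$ is a rank-one locally free $\mathcal C^\infty_{\hat X}$-module.
   Context: **Setting.** $(X,\omega)$ is a connected symplectic manifold with a map $f:X\to B$ whose fibres $X_b$ are $g$-dimensional smooth Lagrangian tori, admitting a Lagrangian section $\sigma$. Then $X\cong T^*B/\Lambda$ as a symplectic manifold fibred in Lagrangian submanifolds, with $\Lambda\subset T^*B$ a Lagrangian covering of $B$ (a lattice in each fibre) and $\sigma$ the zero section. Local action-angle coordinates $(x^1,\dots,x^g,y_1,\dots,y_g)$: the $x^j$ are coordinates on $B$ such that $dx^1,\dots,dx^g$ is a $\mathbb Z$-basis of $\Lambda$, and $(y_j)$ (modulo $\mathbb Z^g$) denotes the point $\sum_j y_j\,dx^j$. The dual family is $\hat f:\hat X=R^1f_*\mathbb R/R^1f_*\mathbb Z\to B$; its fibre $\hat X_b$ is the torus dual to $X_b$, a point $\xi\in\hat X_b$ corresponding to a flat $U(1)$ line bundle $\mathcal L_\xi$ on $X_b$. Local coordinates on $\hat X$ are $(x^j,w^j)$, with $w^j$ dual to $y_j$. On $Z=X\times_B\hat X$ (projections $p,\hat p$) there is the relative Poincaré line bundle $\mathcal P$ with $U(1)$ connection $\nabla_{\mathcal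 P}$: locally over $B$, its sections are functions $s(x,y,w)$ with $s(x,y+\lambda,w+\mu)=e^{-2\pi i\sum_j\mu^jy_j}s(x,y,w)$ for $\lambda,\mu\in\mathbb Z^g$, and $\nabla_{\mathcal P}=d+2\pi i\sum_jw^j\,dy_j$. One has $\mathcal P_{|\hat p^{-1}(\xi)}\cong\mathcal L_\xi$. **Transform.** For a closed submanifold $S\subset X$ let $Z_S=S\times_B\hat X$ with projections $p_S:Z_S\to S$, $\hat p_S:Z_S\to\hat X^S:=\hat p(Z_S)$ and $\mathcal P_S=\mathcal P_{|Z_S}$ (one assumes $\hat X^S$ is a closed submanifold and $\hat p_S$ a submersion; this holds in the present case), and let $r:\Omega^1_{Z_S}\to\Omega^1_{Z_S/\hat X^S}$ be the projection to $\hat p_S$-relative differentials. For a flat $(\mathcal E,\nabla)$ on $S$ let $\nabla^{\mathcal E}$ be the operator on $p_S^*\mathcal E\otimes\mathcal P_S\otimes\Omega^\bullet_{Z_S}$ obtained by coupling the pullback of $\nabla$ with $\nabla_{\mathcal P}$, and $\nabla_r^{\mathcal E}=r\circ\nabla^{\mathcal E}$; $\ker\nabla_r^{\mathcal E}$ is the kernel on $p_S^*\mathcal E\otimes\mathcal P_S$. $(\mathcal E,\nabla)$ is WIT$_k$ if $R^i\hat p_{S,*}\ker\nabla_r^{\mathcal E}=0$ for $i\neq k$. *)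

(* Defs.v *)
From HB Require Import structures.
From mathcomp Require Import all_boot all_order all_algebra.
From mathcomp Require Import all_classical all_reals all_analysis.
From mathcomp.real_closed Require Import complex.

Set Implicit Arguments.
Unset Strict Implicit.
Unset Printing Implicit Defensive.

Import Order.TTheory GRing.Theory Num.Theory.
Import numFieldNormedType.Exports.

Local Open Scope classical_set_scope.
Local Open Scope ring_scope.

Section Euclidean.
Context {R : realType}.
Local Notation C := (complex R).

Definition basis_vec (n : nat) (k : 'I_n) : 'rV[R]_n := delta_mx 0 k.

(* C^p on U, for U open. *)
Fixpoint Cp (p n : nat) (U : set 'rV[R]_n) (f : 'rV[R]_n -> R) : Prop :=
  match p with
  | 0%N => forall x, U x -> {for x, continuous f}
  | p'.+1 => (forall x, U x -> differentiable f x) /\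
             forall k, Cp p' U (fun x => 'D_(basis_vec k) f x)
  end.

Definition Cinfty (n : nat) (U : set 'rV[R]_n) (f : 'rV[R]_n -> R) :=
  forall p, Cp p U f.

Lemma differentiable_near_eq (n : nat) (f g : 'rV[R]_n -> R) x :
  {near x, f =1 g} -> differentiable f x -> differentiable g x.
Proof.
move=> fg df; have gx : f x = g x := nbhs_singleton fg.
have [cf fE] := (diff_locallyP x f).1 df.
have gE : g \o shift x = cst (g x) + 'd f x +o_ (0 : 'rV[R]_n) id.
  apply/eqaddoP => e e0; have /eqaddoP/(_ e e0) := fE => fE'.
  have fg0 : \forall h \near (0 : 'rV[R]_n), f (h + x) = g (h + x).
    by have := fg; rewrite (near_shift 0) /=; apply: filterS => h; rewrite subr0.
  near=> h.
  have -> : (g \o shift x - (cst (g x) + 'd f x)) h =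
            (f \o shift x - (cst (f x) + 'd f x)) h.
    rewrite -gx !fctE /=; congr (_ - _); apply/esym.
    by near: h.
  by near: h.
have dgE : 'd g x = 'd f x :> (_ -> _) by exact: diff_unique cf gE.
by apply/diff_locallyP; rewrite dgE.
Unshelve. all: by end_near. Qed.

Lemma open_near_eq (n : nat) (U : set 'rV[R]_n) (f g : 'rV[R]_n -> R) x :
  open U -> U x -> (forall y, U y -> f y = g y) -> {near x, f =1 g}.
Proof. by move=> oU Ux fg; apply: filterS fg _; exact: open_nbhs_nbhs. Qed.

Lemma Cp_eq p n (U : set 'rV[R]_n) (f g : 'rV[R]_n -> R) : open U ->
  (forall x, U x -> f x = g x) -> Cp p U f -> Cp p U g.
Proof.
move=> oU; elim: p f g => [|p IH] f g fg /=.
  move=> cf x Ux; rewrite /prop_for /continuous_at -(fg x Ux).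
  apply: cvg_trans (cf x Ux); apply: (@near_eq_cvg _ _ (nbhs x)).
  exact: open_near_eq oU Ux fg.
move=> [df pf]; split=> [x Ux|k].
  by apply: differentiable_near_eq (df x Ux); exact: open_near_eq oU Ux fg.
apply: IH (pf k) => x Ux.
by apply: near_eq_derive; exact: open_near_eq oU Ux fg.
Qed.

Lemma Cp_sub p n (U V : set 'rV[R]_n) (f : 'rV[R]_n -> R) :
  V `<=` U -> Cp p U f -> Cp p V f.
Proof.
move=> VU; elim: p f => [|p IH] f /=; first by move=> cf x /VU; exact: cf.
by move=> [df pf]; split=> [x /VU|k]; [exact: df | exact: IH].
Qed.

Lemma Cp_local p n (U : set 'rV[R]_n) (f : 'rV[R]_n -> R) :
  (forall x, U x -> exists2 W, W x & Cp p W f) -> Cp p U f.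
Proof.
elim: p f => [|p IH] f fW /=.
  by move=> x /fW[W Wx cf]; exact: cf.
split=> [x /fW[W Wx [df _]]|k]; first exact: df.
by apply: IH => x /fW[W Wx [_ pf]]; exists W => //; exact: pf.
Qed.

Lemma Cp_cst0 p n (U : set 'rV[R]_n) : Cp p U (fun=> 0 : R).
Proof.
elim: p => [|p IH] /=; first by move=> x _; exact: cst_continuous.
split=> [x _|k]; first exact: differentiable_cst.
by under eq_fun do rewrite derive_cst.
Qed.

Lemma CpB p n (U : set 'rV[R]_n) (f g : 'rV[R]_n -> R) : open U ->
  Cp p U f -> Cp p U g -> Cp p U (fun x => f x - g x).
Proof.
move=> oU; elim: p f g => [|p IH] f g /=.
  by move=> cf cg x Ux; apply: continuousB; [exact: cf | exact: cg].
move=> [df pf] [dg pg]; split=> [x Ux|k].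
  by apply: differentiableB; [exact: df | exact: dg].
apply: Cp_eq (IH _ _ (pf k) (pg k)) => // x Ux.
by rewrite deriveB //; apply: diff_derivable; [exact: df | exact: dg].
Qed.

Definition CinftyC (n : nat) (U : set 'rV[R]_n) (f : 'rV[R]_n -> C) :=
  Cinfty U (fun x => complex.Re (f x)) /\ Cinfty U (fun x => complex.Im (f x)).

Definition pderC (n : nat) (f : 'rV[R]_n -> C) (x : 'rV[R]_n) (k : 'I_n) : C :=
  Complex ('D_(basis_vec k) (fun y => complex.Re (f y)) x)
          ('D_(basis_vec k) (fun y => complex.Im (f y)) x).

Definition integral_vec (n : nat) (v : 'rV[R]_n) :=
  forall j, v 0 j \is a Num.int.

(* exp(2 pi i t) *)
Definition exp2pi (t : R) : C :=
  Complex (cos (2 * pi * t)) (sin (2 * pi * t)).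

End Euclidean.

Record coord (R : realType) (n : nat) (T : Type) := Coord {
  cdom : set T;
  cmap : T -> 'rV[R]_n;
  cinv : 'rV[R]_n -> T }.

Section Coord.
Context {R : realType} {n : nat}.

Definition crange (T : Type) (c : coord R n T) : set 'rV[R]_n :=
  cmap c @` cdom c.

(* c is a homeomorphism from an open set of T onto an open set of R^n. *)
Definition is_coord (T : topologicalType) (c : coord R n T) :=
  [/\ open (cdom c), open (crange c),
      forall x, cdom c x -> cinv c (cmap c x) = x,
      {within cdom c, continuous (cmap c)} &
      {within crange c, continuous (cinv c)}].

Definition compat (T : Type) (c d : coord R n T) :=
  forall j, Cinfty (cmap c @` (cdom c `&` cdom d))
                   (fun u => cmap d (cinv c u) 0 j).

End Coord.

(* [chart_at] is a choice of chart around each point; tangent vectors at x are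
   row vectors, and covectors column vectors, of components with respect to the
   chart [chart_at x]. *)
Record manifold (R : realType) (n : nat) := Manifold {
  mspace :> topologicalType;
  atlas : set (coord R n mspace);
  chart_at : mspace -> coord R n mspace;
  chart_at_atlas : forall x, atlas (chart_at x);
  chart_at_dom : forall x, cdom (chart_at x) x;
  atlas_coord : forall c, atlas c -> is_coord c;
  atlas_compat : forall c d, atlas c -> atlas d -> compat c d;
  manifold_hausdorff : hausdorff_space mspace;
  manifold_countable : @second_countable mspace }.

Section Manifold.
Context {R : realType}.
Local Notation C := (complex R).

(* local coordinates: the charts of the maximal atlas *)
Definition local_coord (n : nat) (M : manifold R n) (c : coord R n M) :=
  is_coord c /\ forall d, atlas d -> compat c d /\ compat d c.

Definition msmooth (n : nat) (M : manifold R n) (V : set M) (f : M -> R) :=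
  forall c, atlas c -> Cinfty (cmap c @` (V `&` cdom c)) (f \o cinv c).

Definition msmoothC (n : nat) (M : manifold R n) (V : set M) (f : M -> C) :=
  forall c, atlas c -> CinftyC (cmap c @` (V `&` cdom c)) (f \o cinv c).

Lemma chart_image_open (n : nat) (M : manifold R n) (c : coord R n M)
    (V : set M) : atlas c -> open V -> open (cmap c @` (V `&` cdom c)).
Proof.
move=> /atlas_coord[odom oran cK _ cinvc] oV.
rewrite (_ : _ @` _ = crange c `&` cinv c @^-1` V); last first.
  apply/seteqP; split=> [_ [x [Vx cx] <-]|_ [[x cx <-] /=]].
    by split; [exists x | rewrite /= cK].
  by rewrite cK // => Vx; exists x.
rewrite openE => u [ru Vu]; apply: filterI; first exact: open_nbhs_nbhs.
move: cinvc; rewrite continuous_open_subspace // => /(_ u).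
by rewrite inE => /(_ ru); apply; exact: open_nbhs_nbhs.
Qed.

Definition smooth_map (m n : nat) (M : manifold R m) (N : manifold R n)
    (h : M -> N) :=
  continuous h /\
  forall V f, open V -> msmooth V f -> msmooth (h @^-1` V) (f \o h).

(* smooth map from an open set W of R^m to a manifold *)
Definition smooth_plot (m n : nat) (N : manifold R n) (W : set 'rV[R]_m)
    (h : 'rV[R]_m -> N) :=
  {within W, continuous h} /\
  forall V f, open V -> msmooth V f -> Cinfty (W `&` h @^-1` V) (f \o h).

(* Matrix of the differential, acting on row vectors on the right. *)
Definition plot_jac (m n : nat) (N : manifold R n) (h : 'rV[R]_m -> N)
    (u : 'rV[R]_m) : 'M[R]_(m, n) :=
  jacobian (fun v => cmap (chart_at (h u)) (h v)) u.

Definition mjac (m n : nat) (M : manifold R m) (N : manifold R n)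
    (h : M -> N) (x : M) : 'M[R]_(m, n) :=
  plot_jac (fun v => h (cinv (chart_at x) v)) (cmap (chart_at x) x).

Definition mderC (n : nat) (M : manifold R n) (f : M -> C) (x : M) (k : 'I_n)
    : C :=
  pderC (f \o cinv (chart_at x)) (cmap (chart_at x) x) k.

End Manifold.

Record smap (R : realType) (m n : nat) (M : manifold R m) (N : manifold R n) :=
  Smap { sfun :> M -> N; smapP : smooth_map sfun }.

Section MoreManifolds.
Context {R : realType}.

(* A closed embedding: a homeomorphism onto a closed subset such that every
   smooth function on M is locally the restriction of a smooth function on N. *)
Definition closed_embedding (m n : nat) (M : manifold R m) (N : manifold R n)
    (h : smap M N) :=
  [/\ injective h, forall A, closed A -> closed (h @` A) &
      forall V f, open V -> msmooth V f -> forall x, V x ->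
        exists U e, [/\ open U /\ U (h x), msmooth U e, h @^-1` U `<=` V &
                        forall y, U (h y) -> e (h y) = f y]].

(* (P, p, q) is the fibre product of a and b in the category of manifolds. *)
Definition fibre_product (l m n k : nat) (P : manifold R l) (M : manifold R m)
    (N : manifold R n) (B : manifold R k)
    (p : P -> M) (q : P -> N) (a : M -> B) (b : N -> B) :=
  [/\ smooth_map p, smooth_map q, forall z, a (p z) = b (q z) &
      forall (d : nat) (T : manifold R d) (u : T -> M) (v : T -> N),
        smooth_map u -> smooth_map v -> (forall t, a (u t) = b (v t)) ->
        exists! h : T -> P, [/\ smooth_map h, forall t, p (h t) = u t &
                                forall t, q (h t) = v t]].

(* A 2-form is given at x by the matrix of its values on the basis of T_x M
   attached to the chart [chart_at x]. *)
Definition pull2_plot (m n : nat) (M : manifold R n) (w : M -> 'M[R]_n)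
    (h : 'rV[R]_m -> M) (u : 'rV[R]_m) : 'M[R]_m :=
  plot_jac h u *m w (h u) *m (plot_jac h u)^T.

Definition pull2 (m n : nat) (M : manifold R m) (N : manifold R n)
    (w : N -> 'M[R]_n) (h : M -> N) (x : M) : 'M[R]_m :=
  mjac h x *m w (h x) *m (mjac h x)^T.

Definition symplectic_form (n : nat) (M : manifold R n) (w : M -> 'M[R]_n) :=
  [/\ forall x, (w x)^T = - w x,
      forall x, w x \in unitmx,
      forall c, atlas c -> forall i j,
        Cinfty (crange c) (fun u => pull2_plot w (cinv c) u i j) &
      forall c, atlas c -> forall u, crange c u -> forall i j k,
        'D_(basis_vec i) (fun v => pull2_plot w (cinv c) v j k) u
        + 'D_(basis_vec j) (fun v => pull2_plot w (cinv c) v k i) u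
        + 'D_(basis_vec k) (fun v => pull2_plot w (cinv c) v i j) u = 0].

(* A is an embedded torus R^g/Z^g, of half the dimension of M, on which the
   form w vanishes. *)
Definition lagrangian_torus (g : nat) (M : manifold R (g + g))
    (w : M -> 'M[R]_(g + g)) (A : set M) :=
  exists t : 'rV[R]_g -> M,
    [/\ smooth_plot setT t, range t = A,
        forall u v, t u = t v <-> integral_vec (u - v),
        forall u, row_free (plot_jac t u) & forall u, pull2_plot w t u = 0].

End MoreManifolds.

(* Complex vector bundle of rank r with a connection, in local frames indexed
   by [bI]: a section is a family of functions s_i with s_i = g_ij s_j, where
   g_ij = [btr i j], and its covariant derivative is ds_i + A_i s_i, where
   [bconn i x k] is the k-th component of the matrix-valued 1-form A_i at x. *)
Record bundle (R : realType) (n : nat) (M : manifold R n) (r : nat) := Bundle {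
  bI : Type;
  bdom : bI -> set M;
  bdom_open : forall i, open (bdom i);
  btr : bI -> bI -> M -> 'M[complex R]_r;
  bconn : bI -> M -> 'I_n -> 'M[complex R]_r }.

Section BundleDef.
Context {R : realType}.
Local Notation C := (complex R).

Definition pull1_plot (m n r : nat) (M : manifold R n)
    (a : M -> 'I_n -> 'M[C]_r) (h : 'rV[R]_m -> M) (u : 'rV[R]_m) (k : 'I_m)
    : 'M[C]_r :=
  \sum_(l < n) real_complex R (plot_jac h u k l) *: a (h u) l.

Definition pull1 (m n r : nat) (M : manifold R m) (N : manifold R n)
    (a : N -> 'I_n -> 'M[C]_r) (h : M -> N) (x : M) (k : 'I_m) : 'M[C]_r :=
  \sum_(l < n) real_complex R (mjac h x k l) *: a (h x) l.

Definition pderMx (n p q : nat) (a : 'rV[R]_n -> 'M[C]_(p, q))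
    (u : 'rV[R]_n) (k : 'I_n) : 'M[C]_(p, q) :=
  \matrix_(i, j) pderC (fun v => a v i j) u k.

Definition mderMx (n p q : nat) (M : manifold R n) (a : M -> 'M[C]_(p, q))
    (x : M) (k : 'I_n) : 'M[C]_(p, q) :=
  \matrix_(i, j) mderC (fun y => a y i j) x k.

Definition is_bundle (n r : nat) (M : manifold R n) (E : bundle M r) :=
  [/\ forall x, exists i : bI E, bdom i x,
      (forall i j : bI E, forall a b,
         msmoothC (bdom i `&` bdom j) (fun x => btr i j x a b)) /\
      (forall (i : bI E) c, atlas c -> forall k a b,
         CinftyC (cmap c @` (bdom i `&` cdom c))
                 (fun u => pull1_plot (bconn i) (cinv c) u k a b)),
      forall (i : bI E) x, bdom i x -> btr i i x = 1%:M,
      forall (i j k : bI E) x, bdom i x -> bdom j x -> bdom k x ->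
        btr i k x = btr i j x *m btr j k x &
      forall (i j : bI E) x, bdom i x -> bdom j x -> forall k,
        btr i j x *m bconn j x k
        = bconn i x k *m btr i j x + mderMx (btr i j) x k].

(* vanishing of the curvature dA + A /\ A *)
Definition flat (n r : nat) (M : manifold R n) (E : bundle M r) :=
  forall (i : bI E) c, atlas c -> forall u, (cmap c @` (bdom i `&` cdom c)) u ->
  let a k v := pull1_plot (bconn i) (cinv c) v k in
  forall k l, pderMx (a l) u k - pderMx (a k) u l
              + a k u *m a l u - a l u *m a k u = 0.

Definition adjointC (r : nat) (a : 'M[C]_r) : 'M[C]_r :=
  (map_mx Num.conj a)^T.

(* U(r) transition functions and u(r)-valued connection forms *)
Definition unitary (n r : nat) (M : manifold R n) (E : bundle M r) :=
  (forall (i j : bI E) x, bdom i x -> bdom j x ->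
     btr i j x *m adjointC (btr i j x) = 1%:M) /\
  (forall (i : bI E) x, bdom i x -> forall k,
     adjointC (bconn i x k) = - bconn i x k).

Lemma bdom_preimage_open (m n r : nat) (M : manifold R m) (N : manifold R n)
    (h : smap M N) (E : bundle N r) (i : bI E) : open (h @^-1` bdom i).
Proof.
by apply: open_comp (bdom_open i) => x _; case: (smapP h) => + _; apply.
Qed.

Definition bpull (m n r : nat) (M : manifold R m) (N : manifold R n)
    (h : smap M N) (E : bundle N r) : bundle M r :=
  {| bI := bI E;
     bdom := fun i => h @^-1` bdom i;
     bdom_open := bdom_preimage_open h (E := E);
     btr := fun i j x => btr i j (h x);
     bconn := fun i => pull1 (bconn i) h |}.

Lemma bdom_inter_open (n r : nat) (M : manifold R n) (E : bundle M r)
    (L : bundle M 1) (i : bI E * bI L) : open (bdom i.1 `&` bdom i.2).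
Proof. by apply: openI; exact: bdom_open. Qed.

(* E (x) L with the coupled connection, for a line bundle L *)
Definition btensor (n r : nat) (M : manifold R n) (E : bundle M r)
    (L : bundle M 1) : bundle M r :=
  {| bI := (bI E * bI L)%type;
     bdom := fun i => bdom i.1 `&` bdom i.2;
     bdom_open := bdom_inter_open (E := E) (L := L);
     btr := fun i j x => btr i.2 j.2 x 0 0 *: btr i.1 j.1 x;
     bconn := fun i x k => bconn i.1 x k + (bconn i.2 x k 0 0)%:M |}.

End BundleDef.

Record opens (T : topologicalType) := Opens {
  oset :> set T;
  osetP : open oset }.

Record presheaf (T : topologicalType) := Presheaf {
  psec :> opens T -> zmodType;
  pres : forall U V : opens T, V `<=` U -> psec U -> psec V;
  presB : forall (U V : opens T) (h : V `<=` U) s t,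
    pres h (s - t) = pres h s - pres h t;
  pres_id : forall (U : opens T) (h : U `<=` U) s, pres h s = s;
  pres_comp : forall (U V W : opens T) (hVU : V `<=` U) (hWV : W `<=` V)
    (hWU : W `<=` U) s, pres hWV (pres hVU s) = pres hWU s }.

Record phom (T : topologicalType) (F G : presheaf T) := Phom {
  phom_fun :> forall U : opens T, F U -> G U;
  phomB : forall U s t, phom_fun (U := U) (s - t) = phom_fun s - phom_fun t;
  phom_res : forall (U V : opens T) (h : V `<=` U) s,
    phom_fun (pres h s) = pres h (phom_fun s) }.

Definition opens_preimage (T T' : topologicalType) (h : T -> T')
    (ch : continuous h) (V : opens T') : opens T :=
  Opens (open_comp (fun x _ => ch x) (osetP V)).

Section Sheaves.
Context {T : topologicalType}.

Definition is_sheaf (F : presheaf T) :=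
  forall (J : Type) (U : opens T) (V : J -> opens T)
         (hV : forall j, V j `<=` U) (s : forall j, F (V j)),
  (forall x, oset U x -> exists j, oset (V j) x) ->
  (forall (j k : J) (W : opens T) (hj : W `<=` V j) (hk : W `<=` V k),
     pres hj (s j) = pres hk (s k)) ->
  exists! t : F U, forall j, pres (hV j) t = s j.

Definition monic (F G : presheaf T) (a : phom F G) :=
  forall U, injective (a U).

(* exactness at G of F -> G -> H, as a sequence of sheaves *)
Definition exact_at (F G H : presheaf T) (a : phom F G) (b : phom G H) :=
  (forall U s, b U (a U s) = 0) /\
  (forall U (t : G U), b U t = 0 -> forall x, oset U x ->
     exists (V : opens T) (h : V `<=` U) (s : F V), oset V x /\ a V s = pres h t).

Definition injective_sheaf (I : presheaf T) :=
  is_sheaf I /\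
  forall (F G : presheaf T) (m : phom F G) (a : phom F I),
    is_sheaf F -> is_sheaf G -> monic m ->
    exists b : phom G I, forall U s, b U (m U s) = a U s.

Definition injective_resolution (F : presheaf T) (I : nat -> presheaf T)
    (e : phom F (I 0%N)) (d : forall k, phom (I k) (I k.+1)) :=
  [/\ forall k, injective_sheaf (I k), monic e, exact_at e (d 0%N) &
      forall k, exact_at (d k) (d k.+1)].

End Sheaves.

Section Pushforward.
Context {T T' : topologicalType} (h : T -> T') (ch : continuous h).

Lemma opens_preimage_sub (U V : opens T') : V `<=` U ->
  opens_preimage ch V `<=` opens_preimage ch U.
Proof. by move=> VU x; exact: VU. Qed.

Definition pushforward (F : presheaf T) : presheaf T' :=
  {| psec := fun V => F (opens_preimage ch V);
     pres := fun U V (hVU : V `<=` U) =>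
       pres (opens_preimage_sub hVU);
     presB := fun U V hVU => presB (opens_preimage_sub hVU);
     pres_id := fun U hUU => pres_id (opens_preimage_sub hUU);
     pres_comp := fun U V W hVU hWV hWU =>
       pres_comp (opens_preimage_sub hVU) (opens_preimage_sub hWV)
                 (opens_preimage_sub hWU) |}.

Definition pushforward_hom (F G : presheaf T) (a : phom F G) :
    phom (pushforward F) (pushforward G) :=
  @Phom _ (pushforward F) (pushforward G) (fun V => a (opens_preimage ch V))
    (fun V => @phomB _ _ _ a (opens_preimage ch V))
    (fun U V hVU => phom_res a (opens_preimage_sub hVU)).

(* R^i h_* F = 0: the i-th cohomology sheaf of h_* I vanishes, for the
   injective resolutions I of F. *)
Definition direct_image_vanishes (F : presheaf T) (i : nat) :=
  forall (I : nat -> presheaf T) (e : phom F (I 0%N))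
         (d : forall k, phom (I k) (I k.+1)),
  injective_resolution e d ->
  match i with
  | 0%N => monic (pushforward_hom (d 0%N))
  | k.+1 => exact_at (pushforward_hom (d k)) (pushforward_hom (d k.+1))
  end.

End Pushforward.

(* module structure over the sheaf of complex-valued smooth functions *)
Record smooth_module (R : realType) (n : nat) (M : manifold R n)
    (F : presheaf M) := SmoothModule {
  act : forall U : opens M, (M -> complex R) -> F U -> F U;
  act_ext : forall (U : opens M) a b (s : F U),
    (forall x, oset U x -> a x = b x) -> act a s = act b s;
  act1 : forall (U : opens M) (s : F U), act (fun=> 1) s = s;
  actA : forall (U : opens M) a b (s : F U), msmoothC U a -> msmoothC U b ->
    act (fun x => a x * b x) s = act a (act b s);
  actDl : forall (U : opens M) a b (s : F U), msmoothC U a -> msmoothC U b ->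
    act (fun x => a x + b x) s = act a s + act b s;
  actDr : forall (U : opens M) a (s t : F U), msmoothC U a ->
    act a (s + t) = act a s + act a t;
  act_res : forall (U V : opens M) (h : V `<=` U) a (s : F U), msmoothC U a ->
    pres h (act a s) = act a (pres h s) }.

Definition locally_free (R : realType) (n : nat) (M : manifold R n)
    (F : presheaf M) (A : smooth_module F) (r : nat) :=
  forall x : M, exists (U : opens M) (e : 'I_r -> F U),
    oset U x /\
    forall (V : opens M) (hVU : V `<=` U) (s : F V),
      (exists a : 'I_r -> M -> complex R,
         (forall k, msmoothC V (a k)) /\
         s = \sum_(k < r) act A (a k) (pres hVU (e k))) /\
      (forall a b : 'I_r -> M -> complex R,
         (forall k, msmoothC V (a k)) -> (forall k, msmoothC V (b k)) ->
         \sum_(k < r) act A (a k) (pres hVU (e k))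
         = \sum_(k < r) act A (b k) (pres hVU (e k)) ->
         forall k y, oset V y -> a k y = b k y).

Section RelativeKernel.
Context {R : realType} {n m r : nat} {Z : manifold R n} {Y : manifold R m}.
Local Notation C := (complex R).
Variables (E : bundle Z r) (q : smap Z Y).

Definition raw_section := bI E -> Z -> 'cV[C]_r.

(* The component functions of a section over V are extended by 0, so that
   equal sections are equal families of functions. *)
Definition is_section (V : set Z) (s : raw_section) :=
  [/\ forall i a, msmoothC (V `&` bdom i) (fun x => s i x a 0),
      forall i j x, V x -> bdom i x -> bdom j x ->
        s i x = btr i j x *m s j x &
      forall i x, ~ (V x /\ bdom i x) -> s i x = 0].

Definition covariant (s : raw_section) (i : bI E) (x : Z) (k : 'I_n)
    : 'cV[C]_r :=
  mderMx (s i) x k + bconn i x k *m s i x.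

(* The relative differentials are the quotient of Omega^1_Z by the forms pulled
   back from Y: an E-valued 1-form goes to 0 in it iff at every point it is in
   the image of E (x) q^* T^*Y. *)
Definition relatively_flat (V : set Z) (s : raw_section) :=
  forall i x, V x -> bdom i x -> exists b : 'I_m -> 'cV[C]_r,
    forall k, covariant s i x k
              = \sum_(l < m) real_complex R (mjac q x k l) *: b l.

Definition ker_pred (V : opens Z) : pred raw_section :=
  fun s => `[< is_section V s /\ relatively_flat V s >].

Lemma ReB (a b : C) : complex.Re (a - b) = complex.Re a - complex.Re b.
Proof. by case: a b => [? ?] [? ?]. Qed.

Lemma ImB (a b : C) : complex.Im (a - b) = complex.Im a - complex.Im b.
Proof. by case: a b => [? ?] [? ?]. Qed.

Lemma section_chart_smooth (V : opens Z) (s : raw_section) i a :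
  is_section V s -> forall c, atlas c ->
  CinftyC (cmap c @` ((oset V `&` bdom i) `&` cdom c))
          ((fun x => s i x a 0) \o cinv c).
Proof. by move=> [sm _ _] c ac; exact: sm. Qed.

Lemma section_open (V : opens Z) (i : bI E) c : atlas c ->
  open (cmap c @` ((oset V `&` bdom i) `&` cdom c)).
Proof.
by move=> ac; apply: chart_image_open => //; apply: openI;
  [exact: osetP | exact: bdom_open].
Qed.

Lemma covariantB (V : opens Z) (s t : raw_section) i x k :
  is_section V s -> is_section V t -> oset V x -> bdom i x ->
  covariant (s - t) i x k = covariant s i x k - covariant t i x k.
Proof.
move=> Ss St Vx ix; rewrite /covariant mulmxBr opprD addrACA; congr (_ + _).
apply/matrixP => a b; rewrite !mxE (ord1 b) /mderC /pderC.
have ac := chart_at_atlas x.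
have Wx : (cmap (chart_at x) @` ((oset V `&` bdom i) `&` cdom (chart_at x)))
            (cmap (chart_at x) x).
  by exists x => //; split=> //; exact: chart_at_dom.
have [/(_ 1%N)[+ _] /(_ 1%N)[+ _]] := section_chart_smooth i a Ss ac.
move=> /(_ _ Wx) ds1 /(_ _ Wx) ds2.
have [/(_ 1%N)[+ _] /(_ 1%N)[+ _]] := section_chart_smooth i a St ac.
move=> /(_ _ Wx) dt1 /(_ _ Wx) dt2.
apply/eqP; rewrite eq_complex /=; apply/andP; split; apply/eqP.
- apply: etrans (deriveB (diff_derivable ds1) (diff_derivable dt1)).
  by apply: near_eq_derive; apply: open_near_eq openT I _ => y _; rewrite !fctE !mxE ReB.
- apply: etrans (deriveB (diff_derivable ds2) (diff_derivable dt2)).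
  by apply: near_eq_derive; apply: open_near_eq openT I _ => y _; rewrite !fctE !mxE ImB.
Qed.

Lemma ker_pred_zmod (V : opens Z) : zmod_closed (ker_pred V).
Proof.
split=> [|s t /asboolP[Ss Fs] /asboolP[St Ft]]; apply/asboolP.
  split; first split.
  - move=> i a c ac.
    rewrite (_ : _ \o _ = fun=> 0); last by apply/funext => u /=; rewrite mxE.
    by split=> p; exact: Cp_cst0.
  - by move=> i j x _ _ _; rewrite mulmx0.
  - by [].
  move=> i x Vx ix; exists (fun=> 0) => k.
  under eq_bigr do rewrite scaler0.
  rewrite big1 // /covariant mulmx0 addr0; apply/matrixP => a b; rewrite !mxE.
  rewrite /mderC (_ : _ \o _ = fun=> 0); last by apply/funext => u /=; rewrite mxE.
  by rewrite [RHS]mxE /pderC !derive_cst.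
split; first split.
- move=> i a c ac.
  have [s1 s2] := section_chart_smooth i a Ss ac.
  have [t1 t2] := section_chart_smooth i a St ac.
  have oW := @section_open V i c ac.
  split=> p.
    apply: Cp_eq (CpB oW (s1 p) (t1 p)) => // u _.
    by rewrite /= !fctE !mxE ReB.
  apply: Cp_eq (CpB oW (s2 p) (t2 p)) => // u _.
  by rewrite /= !fctE !mxE ImB.
- case: Ss St => _ sE _ [_ tE _] i j x Vx ix jx.
  by rewrite !fctE (sE i j) // (tE i j) // mulmxBr.
- case: Ss St => _ _ s0 [_ _ t0] i x nx.
  by rewrite !fctE s0 // t0 // subr0.
move=> i x Vx ix; have [b bE] := Fs i x Vx ix; have [d dE] := Ft i x Vx ix.
exists (fun l => b l - d l) => k.
rewrite (covariantB k Ss St Vx ix) bE dE -sumrB.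
by apply: eq_bigr => l _; rewrite scalerBr.
Qed.

HB.instance Definition _ (V : opens Z) :=
  GRing.isZmodClosed.Build raw_section (ker_pred V) (ker_pred_zmod V).

Record ker_sec (V : opens Z) := KerSec {
  ker_val :> raw_section;
  ker_valP : ker_pred V ker_val }.

HB.instance Definition _ V := [isSub for @ker_val V].
HB.instance Definition _ V := [Choice of ker_sec V by <:].
HB.instance Definition _ V := [SubChoice_isSubZmodule of ker_sec V by <:].

Definition raw_res (V : set Z) (s : raw_section) : raw_section :=
  fun i x => if `[< V x >] then s i x else 0.

Lemma covariant_eq (V : opens Z) (s t : raw_section) i x k :
  (forall y, oset V y -> s i y = t i y) -> oset V x ->
  covariant s i x k = covariant t i x k.
Proof.
move=> st Vx; rewrite /covariant st //; congr (_ + _).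
apply/matrixP => a b; rewrite !mxE /mderC /pderC.
have ac := chart_at_atlas x.
have Wx : (cmap (chart_at x) @` (oset V `&` cdom (chart_at x)))
            (cmap (chart_at x) x).
  by exists x => //; split=> //; exact: chart_at_dom.
have oW := chart_image_open ac (osetP V).
have E0 u : (cmap (chart_at x) @` (oset V `&` cdom (chart_at x))) u ->
    s i (cinv (chart_at x) u) = t i (cinv (chart_at x) u).
  by move=> [y [Vy cy] <-]; have [_ _ cK _ _] := atlas_coord ac;
    rewrite cK // st.
by congr Complex; apply: near_eq_derive; apply: open_near_eq oW Wx _ => u Wu;
  rewrite /= E0.
Qed.

Lemma raw_res_ker (U V : opens Z) (s : raw_section) :
  V `<=` U -> ker_pred U s -> ker_pred V (raw_res V s).
Proof.
move=> VU /asboolP[Ss Fs]; apply/asboolP.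
have resE i x : oset V x -> raw_res V s i x = s i x.
  by move=> Vx; rewrite /raw_res asboolT.
split; first split.
- move=> i a c ac.
  have [s1 s2] := section_chart_smooth i a Ss ac.
  have oW := @section_open V i c ac.
  have sub : cmap c @` ((oset V `&` bdom i) `&` cdom c) `<=`
             cmap c @` ((oset U `&` bdom i) `&` cdom c).
    by move=> _ [x [[Vx ix] cx] <-]; exists x => //; split=> //; split=> //;
      exact: VU.
  have E0 u : (cmap c @` ((oset V `&` bdom i) `&` cdom c)) u ->
      s i (cinv c u) a 0 = raw_res V s i (cinv c u) a 0.
    by move=> [x [[Vx ix] cx] <-]; have [_ _ cK _ _] := atlas_coord ac;
      rewrite cK // resE.
  split=> p.
    by apply: Cp_eq (Cp_sub sub (s1 p)) => // u Wu; rewrite /= E0.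
  by apply: Cp_eq (Cp_sub sub (s2 p)) => // u Wu; rewrite /= E0.
- case: Ss => _ sE _ i j x Vx ix jx.
  by rewrite !resE // (sE i j) //; exact: VU.
- case: Ss => _ _ s0 i x nx; rewrite /raw_res; case: asboolP => // Vx.
  by rewrite s0 // => -[_ ix]; apply: nx.
move=> i x Vx ix; have [b bE] := Fs i x (VU x Vx) ix; exists b => k.
rewrite -bE; apply: (covariant_eq k _ Vx) => y; exact: resE.
Qed.

Definition ker_res (U V : opens Z) (h : V `<=` U) (s : ker_sec U) : ker_sec V :=
  KerSec (raw_res_ker h (ker_valP s)).

Lemma ker_resB (U V : opens Z) (h : V `<=` U) (s t : ker_sec U) :
  ker_res h (s - t) = ker_res h s - ker_res h t.
Proof.
apply: val_inj; apply/funext => i; apply/funext => x /=.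
by rewrite /raw_res !fctE; case: ifP => _; rewrite ?subr0.
Qed.

Lemma ker_res_id (U : opens Z) (h : U `<=` U) (s : ker_sec U) :
  ker_res h s = s.
Proof.
apply: val_inj; apply/funext => i; apply/funext => x /=; rewrite /raw_res.
case: asboolP => // nUx; case: s => s /= /asboolP[[_ _ s0] _].
by rewrite s0 // => -[].
Qed.

Lemma ker_res_comp (U V W : opens Z) (hVU : V `<=` U) (hWV : W `<=` V)
    (hWU : W `<=` U) (s : ker_sec U) :
  ker_res hWV (ker_res hVU s) = ker_res hWU s.
Proof.
apply: val_inj; apply/funext => i; apply/funext => x /=; rewrite /raw_res.
by case: asboolP => // Wx; rewrite asboolT //; exact: hWV.
Qed.

Definition ker_presheaf : presheaf Z :=
  {| psec := fun V => ker_sec V : zmodType;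
     pres := ker_res;
     presB := ker_resB;
     pres_id := ker_res_id;
     pres_comp := ker_res_comp |}.

Lemma ker_res_eq (U V : opens Z) (h : V `<=` U) (s : ker_sec U) (t : ker_sec V)
    i x : ker_res h s = t -> oset V x -> ker_val s i x = ker_val t i x.
Proof. by move=> <- Vx; rewrite /= /raw_res asboolT. Qed.

Lemma ker_presheaf_sheaf : is_sheaf ker_presheaf.
Proof.
move=> J U V hV s covU scompat.
have sE j k i x : oset (V j) x -> oset (V k) x ->
    ker_val (s j : ker_sec _) i x = ker_val (s k : ker_sec _) i x.
  move=> Vj Vk; pose W := Opens (openI (osetP (V j)) (osetP (V k))).
  have hj : W `<=` V j by move=> y [].
  have hk : W `<=` V k by move=> y [].
  have Wx : oset W x by [].
  by rewrite (ker_res_eq i (scompat j k W hj hk) Wx) /= /raw_res asboolT.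
pose t : raw_section := fun i x =>
  match pselect (exists j, oset (V j) x) with
  | left h => ker_val (s (projT1 (cid h)) : ker_sec _) i x
  | right _ => 0
  end.
have tE j i x : oset (V j) x -> t i x = ker_val (s j : ker_sec _) i x.
  move=> Vx; rewrite /t; case: pselect => [h|[]]; last by exists j.
  by apply: sE => //; case: (cid h).
have sP j : is_section (V j) (ker_val (s j : ker_sec _)) /\
            relatively_flat (V j) (ker_val (s j : ker_sec _)).
  exact/asboolP/(ker_valP (s j : ker_sec _)).
have tP : ker_pred U t.
  apply/asboolP; split; first split.
  - move=> i a c ac; have [_ _ cK _ _] := atlas_coord ac.
    have loc u : (cmap c @` ((oset U `&` bdom i) `&` cdom c)) u -> exists j,
        (cmap c @` ((oset (V j) `&` bdom i) `&` cdom c)) u.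
      by move=> [x [[/covU[j Vx] ix] cx] <-]; exists j; exists x.
    have locE j u : (cmap c @` ((oset (V j) `&` bdom i) `&` cdom c)) u ->
        ker_val (s j : ker_sec _) i (cinv c u) = t i (cinv c u).
      by move=> [x [[Vx ix] cx] <-]; rewrite cK // (tE j).
    split=> p; apply: Cp_local => u /loc[j Wu];
      exists (cmap c @` ((oset (V j) `&` bdom i) `&` cdom c)) => //;
      have [s1 s2] := section_chart_smooth i a (sP j).1 ac;
      have oW := @section_open (V j) i c ac.
    + by apply: Cp_eq (s1 p) => // v Wv; rewrite /= (locE j).
    + by apply: Cp_eq (s2 p) => // v Wv; rewrite /= (locE j).
  - move=> i i' x /covU[j Vx] ix ix'; rewrite !(tE j) //.
    by have [[_ + _] _] := sP j; apply.
  - move=> i x nx; rewrite /t; case: pselect => // h; case: (cid h) => j /= Vx.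
    by have [[_ _ +] _] := sP j; apply=> -[_ ix]; apply: nx; split=> //; exact: hV Vx.
  move=> i x /covU[j Vx] ix; have [b bE] := (sP j).2 i x Vx ix.
  exists b => k; rewrite -bE; apply: (covariant_eq k _ Vx) => y; exact: tE.
exists (KerSec tP); split=> [j|t' t'E].
  apply: val_inj; apply/funext => i; apply/funext => x /=; rewrite /raw_res.
  case: asboolP => [Vx|nVx]; first exact: tE.
  by have [[_ _ +] _] := sP j => ->// -[].
apply: val_inj; apply/funext => i; apply/funext => x /=.
have [Ux|nUx] := pselect (oset U x); last first.
  have /asboolP[[_ _ t0] _] := ker_valP (KerSec tP).
  have /asboolP[[_ _ t0'] _] := ker_valP (t' : ker_sec _).
  by rewrite [RHS]t0' => [|[]//]; rewrite -[LHS]/(ker_val (KerSec tP) i x) t0 // => -[].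
have [j Vx] := covU x Ux.
by rewrite (tE j) //; apply/esym; exact: ker_res_eq (t'E j) Vx.
Qed.

End RelativeKernel.

Record torus_family (R : realType) (g : nat) := TorusFamily {
  fB : manifold R g;
  fX : manifold R (g + g);
  fomega : fX -> 'M[R]_(g + g);
  fomegaP : symplectic_form fomega;
  fX_connected : connected [set: fX];
  fproj : smap fX fB;
  fproj_submersion : forall x, row_full (mjac fproj x);
  ffibre : forall b, lagrangian_torus fomega (fproj @^-1` [set b]);
  fzero : smap fB fX;
  fzeroK : forall b, fproj (fzero b) = b;
  fzero_lagrangian : forall b, pull2 fomega fzero b = 0 }.

Section CotangentQuotient.
Context {R : realType} {g : nat}.

Definition lagrangian_section (F : torus_family R g) (s : smap (fB F) (fX F)) :=
  (forall b, fproj F (s b) = b) /\ forall b, pull2 (@fomega _ _ F) s b = 0.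

(* Matrix whose j-th column is the covector dx^j at b. *)
Definition dcoord (B : manifold R g) (c : coord R g B) (b : B) : 'M[R]_g :=
  jacobian (cmap c \o cinv (chart_at b)) (cmap (chart_at b) b).

(* Matrix whose j-th row is the tangent vector d/dx^j at b. *)
Definition coord_frame (B : manifold R g) (c : coord R g B) (b : B) : 'M[R]_g :=
  plot_jac (cinv c) (cmap c b).

Section Period.
Variables (F : torus_family R g) (phi : fB F -> 'cV[R]_g -> fX F).

(* the fibre at b of Lambda *)
Definition period (b : fB F) (l : 'cV[R]_g) := phi b l = fzero F b.

(* (x, y) |-> class of sum_j y_j dx^j *)
Definition angle_map (c : coord R g (fB F)) (z : 'rV[R]_(g + g)) : fX F :=
  let b := cinv c (lsubmx z) in phi b (dcoord c b *m (rsubmx z)^T).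

Definition over_coord (k : nat) (c : coord R g (fB F)) : set 'rV[R]_(g + k) :=
  [set z | crange c (lsubmx z)].

(* sum_j dx^j /\ dy_j *)
Definition canonical_form : 'M[R]_(g + g) := block_mx 0 1%:M (- 1%:M) 0.

Definition action_coord (c : coord R g (fB F)) :=
  [/\ local_coord c,
      forall b, cdom c b -> forall l,
        period b l <-> exists2 m : 'rV[R]_g, integral_vec m &
                                             l = dcoord c b *m m^T,
      smooth_plot (over_coord c) (angle_map c) &
      forall z, over_coord c z ->
        pull2_plot (@fomega _ _ F) (angle_map c) z = canonical_form].

End Period.

End CotangentQuotient.

(* The isomorphism T^*B / Lambda = X over B, with the given Lagrangian section
   as zero section; [phi b] is the resulting covering T_b^*B -> X_b. *)
Record cotangent_quotient (R : realType) (g : nat) (F : torus_family R g) :=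
  CotangentQuotient {
    phi :> fB F -> 'cV[R]_g -> fX F;
    phi_proj : forall b a, fproj F (phi b a) = b;
    phi_surj : forall x, exists a, phi (fproj F x) a = x;
    phi_zero : forall b, phi b 0 = fzero F b;
    phi_eq : forall b a a', phi b a = phi b a' <-> period phi b (a - a');
    phi_action : forall b, exists2 c, action_coord phi c & cdom c b }.

(* (x, w) |-> class of sum_j w^j d/dx^j, for a covering psi of the dual family *)
Definition dual_map (R : realType) (g : nat) (F : torus_family R g)
    (Y : Type) (psi : fB F -> 'rV[R]_g -> Y) (c : coord R g (fB F))
    (z : 'rV[R]_(g + g)) : Y :=
  let b := cinv c (lsubmx z) in psi b (rsubmx z *m coord_frame c b).

(* The dual family. Since X_b = T_b^*B / Lambda_b, one has H_1(X_b, Z) = Lambda_b,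
   H^1(X_b, Z) = Hom(Lambda_b, Z) and H^1(X_b, R) = Hom(Lambda_b, R) = T_b B;
   [psi b] is the covering H^1(X_b, R) -> H^1(X_b, R) / H^1(X_b, Z). The
   coordinates (x, w) attached to action coordinates are local coordinates. *)
Record dual_family (R : realType) (g : nat) (F : torus_family R g)
    (Q : cotangent_quotient F) := DualFamily {
  dX : manifold R (g + g);
  dproj : smap dX (fB F);
  psi : fB F -> 'rV[R]_g -> dX;
  psi_proj : forall b v, dproj (psi b v) = b;
  psi_surj : forall y, exists v, psi (dproj y) v = y;
  psi_eq : forall b v v', psi b v = psi b v' <->
    forall l, period Q b l -> ((v - v') *m l) 0 0 \is a Num.int;
  psi_smooth : forall c, action_coord Q c ->
    smooth_plot (over_coord c) (dual_map psi c) /\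
    forall z, over_coord c z -> plot_jac (dual_map psi c) z \in unitmx }.

Section Poincare.
Context {R : realType} {g : nat}.
Local Notation C := (complex R).

(* A point (x, y, w) of R^g x R^g x R^g *)
Definition xyw_x (z : 'rV[R]_(g + (g + g))) : 'rV[R]_g := lsubmx z.
Definition xyw_y (z : 'rV[R]_(g + (g + g))) : 'rV[R]_g := lsubmx (rsubmx z).
Definition xyw_w (z : 'rV[R]_(g + (g + g))) : 'rV[R]_g := rsubmx (rsubmx z).

(* P is, over the domain of each system c of action coordinates, the line bundle
   whose sections are the s(x, y, w) with
     s(x, y + l, w + m) = exp(- 2 pi i sum_j m^j y_j) s(x, y, w),
   and whose connection is d + 2 pi i sum_j w^j dy_j: on the covering q by
   coordinates (x, y, w) there is a unit frame e, given by its component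
   functions in the local frames of P, such that s e is the section of P
   corresponding to s, that is, e is multiplied by exp(2 pi i sum_j m^j y_j)
   under the translation by (l, m), and nabla e = 2 pi i sum_j w^j dy_j e. *)
Definition poincare (F : torus_family R g) (Q : cotangent_quotient F)
    (D : dual_family Q) (Z : manifold R (g + (g + g)))
    (p : Z -> fX F) (ph : Z -> dX D) (P : bundle Z 1) :=
  forall c, action_coord Q c ->
  exists (q : 'rV[R]_(g + (g + g)) -> Z)
         (e : bI P -> 'rV[R]_(g + (g + g)) -> C),
  let W : set 'rV[R]_(g + (g + g)) := over_coord c in
  [/\ smooth_plot W q /\
      (forall z, W z ->
         p (q z) = angle_map Q c (row_mx (xyw_x z) (xyw_y z)) /\
         ph (q z) = dual_map (@psi _ _ _ _ D) c (row_mx (xyw_x z) (xyw_w z))),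
      (forall i, CinftyC (W `&` q @^-1` bdom i) (e i)) /\
      (forall i z, W z -> bdom i (q z) -> `|e i z| = 1),
      forall i j z, W z -> bdom i (q z) -> bdom j (q z) ->
        e i z = btr i j (q z) 0 0 * e j z,
      forall i z (l m : 'rV[R]_g), W z -> bdom i (q z) ->
        integral_vec l -> integral_vec m ->
        e i (z + row_mx 0 (row_mx l m))
        = exp2pi (\sum_j m 0 j * xyw_y z 0 j) * e i z &
      forall i z, W z -> bdom i (q z) -> forall k,
        pderC (e i) z k + pull1_plot (bconn i) q z k 0 0 * e i z
        = Complex 0 (2 * pi * \sum_(j < g)
              xyw_w z 0 j * (k == rshift g (lshift g j))%:R) * e i z].

End Poincare.

Record poincare_family (R : realType) (g : nat) (F : torus_family R g)
    (Q : cotangent_quotient F) (D : dual_family Q) := PoincareFamily {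
  pZ : manifold R (g + (g + g));
  pX : smap pZ (fX F);
  pD : smap pZ (dX D);
  pZP : fibre_product pX pD (fproj F) (dproj D);
  pP : bundle pZ 1;
  pP_bundle : is_bundle pP;
  pP_unitary : unitary pP;
  pP_poincare : poincare pX pD pP }.

(* A closed submanifold S of X, of dimension k, with Z_S = S x_B X^, the closed
   submanifold \hat X^S = \hat p(Z_S) of X^ and the map Z_S -> Z. *)
Record transform_support (R : realType) (g : nat) (F : torus_family R g)
    (Q : cotangent_quotient F) (D : dual_family Q) (P : poincare_family D)
    (k : nat) := Support {
  sS : manifold R k;
  siota : smap sS (fX F);
  siotaP : closed_embedding siota;
  sdim : nat;
  sY : manifold R sdim;
  skappa : smap sY (dX D);
  skappaP : closed_embedding skappa;
  sZ : manifold R (k + g);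
  sp : smap sZ sS;
  sq : smap sZ sY;
  sq_surj : range sq = [set: sY];
  sZP : fibre_product sp (skappa \o sq) (fproj F \o siota) (dproj D);
  sj : smap sZ (pZ P);
  sj_X : forall z, pX P (sj z) = siota (sp z);
  sj_D : forall z, pD P (sj z) = skappa (sq z) }.

Section Transform.
Context {R : realType} {g : nat} {F : torus_family R g}.
Context {Q : cotangent_quotient F} {D : dual_family Q} {P : poincare_family D}.
Context {k r : nat} (S : transform_support P k) (E : bundle (sS S) r).

Lemma smap_continuous (m n : nat) (M : manifold R m) (N : manifold R n)
  (h : smap M N) : continuous h.
Proof. by case: (smapP h). Qed.

Definition coupled_bundle : bundle (sZ S) r :=
  btensor (bpull (sp S) E) (bpull (sj S) (pP P)).

Definition ker_nabla_r : presheaf (sZ S) := ker_presheaf coupled_bundle (sq S).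

Definition WIT (i : nat) := forall j, j <> i ->
  direct_image_vanishes (@smap_continuous _ _ _ _ (sq S)) ker_nabla_r j.

(* R^0 \hat p_{S,*} ker nabla_r, as a sheaf on X^ supported on \hat X^S *)
Definition transform0 : presheaf (dX D) :=
  pushforward (@smap_continuous _ _ _ _ (skappa S))
    (pushforward (@smap_continuous _ _ _ _ (sq S)) ker_nabla_r).

(* the component functions of a section of [transform0] *)
Definition transform0_val (V : opens (dX D)) (s : transform0 V)
    : raw_section coupled_bundle := ker_val (s : ker_sec _ _ _).

(* A function a on X^ acts by multiplication by its pullback to Z_S. *)
Definition multiplication_action (A : smooth_module transform0) :=
  forall (V : opens (dX D)) a (s : transform0 V), msmoothC V a ->
  forall i z, oset V (skappa S (sq S z)) ->
    transform0_val (act A a s) i z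
    = a (skappa S (sq S z)) *: transform0_val s i z.

End Transform.

(* Main.v *)
Require Import Defs.
From mathcomp Require Import all_boot all_order all_algebra.
From mathcomp Require Import all_classical all_reals all_analysis.
From mathcomp.real_closed Require Import complex.

Set Implicit Arguments.
Unset Strict Implicit.
Unset Printing Implicit Defensive.

Import Order.TTheory GRing.Theory Num.Theory.
Import numFieldNormedType.Exports.

Local Open Scope classical_set_scope.
Local Open Scope ring_scope.

(** The transform is a direct image along \hat p_S, whose fibres here are
points: the transform of L is essentially the line bundle L (x) P itself,
carried over from Z_S to X^.

Since iota : S -> X is a closed embedding with the image of a section s of
f : X -> B, the map f o iota : S -> B is a diffeomorphism; its inverse is the
lift of s through iota, which is smooth because smooth functions on S extend
locally to X ([closed_embedding_lift]).  Base change along f^ : X^ -> B then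
makes kappa o q : Z_S -> X^ a diffeomorphism, by the universal property of the
fibre product ([fibre_product_inverse], [support_dual_diffeo]).  In particular
q = \hat p_S has a smooth two-sided inverse, with two consequences.

First, the direct image along q is a mere transport along a homeomorphism, so
it preserves the exactness of any injective resolution
([pushforward_exact]): all higher direct images vanish, which is WIT_0.

Secondly, by the chain rule the Jacobian of q has a right inverse, so every
1-form on Z_S comes from the base and the relative differentials vanish
([left_inverse_relatively_flat]).  The condition nabla_r s = 0 is thus empty,
and the kernel is the sheaf of all smooth sections of the line bundle
L (x) P on Z_S.  It is a module over the smooth functions on X^ through
kappa o q, and the local frames given by the transition functions of L (x) P
show that it is locally free of rank one ([frame_sec_spans],
[transform_locally_free]). *)

(** * Smooth functions *)

Section Calculus.
Context {R : realType} {n : nat}.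
Implicit Types (U : set 'rV[R]_n) (f g : 'rV[R]_n -> R).

Lemma CpS p U f : Cp p.+1 U f -> Cp p U f.
Proof.
elim: p f => [|p IH] f [df pf]; first by move=> x /df /differentiable_continuous.
by split=> // k; exact/IH/pf.
Qed.

Lemma Cp_cst p U (r : R) : Cp p U (fun=> r).
Proof.
case: p => [|p] /=; first by move=> x _; exact: cst_continuous.
split=> [x _|k]; first exact: differentiable_cst.
by under eq_fun do rewrite derive_cst; exact: Cp_cst0.
Qed.

Lemma CpD p U f g : open U -> Cp p U f -> Cp p U g ->
  Cp p U (fun x => f x + g x).
Proof.
move=> oU cf cg.
have cN : Cp p U (fun x => 0 - g x) by exact: CpB (Cp_cst _ _ _) cg.
by apply: Cp_eq (CpB oU cf cN) => // x _; rewrite sub0r opprK.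
Qed.

(** The product rule expresses the partial derivatives of f g through products
of one derivative with f or g itself, hence the need for [CpS] in the
induction. *)
Lemma CpM p U f g : open U -> Cp p U f -> Cp p U g ->
  Cp p U (fun x => f x * g x).
Proof.
move=> oU; elim: p f g => [|p IH] f g cf cg.
  by move=> x Ux; apply: continuousM; [exact: cf | exact: cg].
have [[df pf] [dg pg]] := (cf, cg).
split=> [x Ux|k]; first by apply: differentiableM; [exact: df | exact: dg].
apply: Cp_eq (CpD oU (IH _ _ (CpS cf) (pg k)) (IH _ _ (CpS cg) (pf k))) => //.
move=> x Ux; apply/esym.
by apply: deriveM; apply: diff_derivable; [exact: df | exact: dg].
Qed.

End Calculus.

(** Smoothness is a condition on coordinate functions, whereas Jacobians are
those of vector-valued maps. *)
Lemma differentiable_rV (R : realType) (m n : nat) (f : 'rV[R]_m -> 'rV[R]_n) x :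
  (forall j, differentiable (fun v => f v 0 j) x) -> differentiable f x.
Proof.
move=> df.
have -> : f = \sum_(j < n) (fun v => f v 0 j *: delta_mx 0 j : 'rV[R]_n).
  by apply/funext => v; rewrite fct_sumE [LHS]row_sum_delta.
apply: differentiable_sum => j.
exact: differentiableZl.
Qed.

Section SmoothFunctions.
Context {R : realType} {n : nat} {M : manifold R n}.
Local Notation C := (complex R).
Implicit Types (U V : set M).

Lemma chart_image_nbhs (c : Defs.coord R n M) V x : atlas c -> open V -> V x ->
  cdom c x -> nbhs (cmap c x) (cmap c @` (V `&` cdom c)).
Proof.
move=> ac oV Vx cx; apply: open_nbhs_nbhs; split; first exact: chart_image_open.
by exists x.
Qed.

Lemma chart_at_nbhs V x : open V -> V x ->
  \forall v \near cmap (chart_at x) x, V (cinv (chart_at x) v).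
Proof.
move=> oV Vx; have ac := chart_at_atlas x; have [_ _ cK _ _] := atlas_coord ac.
apply: filterS (chart_image_nbhs ac oV Vx (chart_at_dom x)).
by move=> _ [y [Vy cy] <-]; rewrite cK.
Qed.

Lemma msmooth_coord (c : Defs.coord R n M) j : atlas c ->
  msmooth (cdom c) (fun x => cmap c x 0 j).
Proof. by move=> ac d ad; rewrite setIC; exact: atlas_compat. Qed.

Lemma msmooth_local V (f : M -> R) :
  (forall x, V x -> exists U g,
     [/\ open U, U x, msmooth U g & forall y, U y -> g y = f y]) ->
  msmooth V f.
Proof.
move=> loc c ac p; have [_ _ cK _ _] := atlas_coord ac.
apply: Cp_local => _ [x [/loc[U [g [oU Ux sg gf]]] cx] <-].
exists (cmap c @` (U `&` cdom c)); first by exists x.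
apply: Cp_eq (sg c ac p); first exact: chart_image_open.
by move=> _ [y [Uy cy] <-]; rewrite /= cK ?gf.
Qed.

Lemma msmooth_sub U V (f : M -> R) : V `<=` U -> msmooth U f -> msmooth V f.
Proof.
move=> VU sf c ac p; apply: Cp_sub (sf c ac p) => _ [x [Vx cx] <-].
by exists x => //; split=> //; exact: VU.
Qed.

Lemma msmooth_eq V (f g : M -> R) : open V -> (forall x, V x -> f x = g x) ->
  msmooth V f -> msmooth V g.
Proof. by move=> oV fg sf; apply: msmooth_local => x Vx; exists V, f. Qed.

Lemma msmooth_cst V (r : R) : msmooth V (fun=> r).
Proof. by move=> c ac p; exact: Cp_cst. Qed.

Lemma msmoothD V (f g : M -> R) : open V -> msmooth V f -> msmooth V g ->
  msmooth V (fun x => f x + g x).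
Proof.
by move=> oV sf sg c ac p; apply: CpD (sf c ac p) (sg c ac p);
  exact: chart_image_open.
Qed.

Lemma msmoothB V (f g : M -> R) : open V -> msmooth V f -> msmooth V g ->
  msmooth V (fun x => f x - g x).
Proof.
by move=> oV sf sg c ac p; apply: CpB (sf c ac p) (sg c ac p);
  exact: chart_image_open.
Qed.

Lemma msmoothM V (f g : M -> R) : open V -> msmooth V f -> msmooth V g ->
  msmooth V (fun x => f x * g x).
Proof.
by move=> oV sf sg c ac p; apply: CpM (sf c ac p) (sg c ac p);
  exact: chart_image_open.
Qed.

Lemma msmoothCP V (f : M -> C) : msmoothC V f <->
  msmooth V (fun x => complex.Re (f x)) /\ msmooth V (fun x => complex.Im (f x)).
Proof.
split=> [sf|[s1 s2] c ac]; last by split; [exact: s1 | exact: s2].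
by split=> c ac; have [] := sf c ac.
Qed.

Lemma msmoothC_sub U V (f : M -> C) : V `<=` U -> msmoothC U f -> msmoothC V f.
Proof.
by move=> VU /msmoothCP[s1 s2]; apply/msmoothCP; split; exact: msmooth_sub VU _.
Qed.

Lemma msmoothC_eq V (f g : M -> C) : open V -> (forall x, V x -> f x = g x) ->
  msmoothC V f -> msmoothC V g.
Proof.
move=> oV fg /msmoothCP[s1 s2]; apply/msmoothCP.
by split; [move: s1 | move: s2]; apply: msmooth_eq => // x /fg ->.
Qed.

Lemma msmoothC_cst V (a : C) : msmoothC V (fun=> a).
Proof. by apply/msmoothCP; split; exact: msmooth_cst. Qed.

Lemma msmoothCD V (f g : M -> C) : open V -> msmoothC V f -> msmoothC V g ->
  msmoothC V (fun x => f x + g x).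
Proof.
move=> oV /msmoothCP[f1 f2] /msmoothCP[g1 g2]; apply/msmoothCP.
split; [apply: msmooth_eq (msmoothD oV f1 g1) | apply: msmooth_eq (msmoothD oV f2 g2)] => // x _;
by case: (f x) (g x) => [? ?] [? ?].
Qed.

Lemma msmoothCM V (f g : M -> C) : open V -> msmoothC V f -> msmoothC V g ->
  msmoothC V (fun x => f x * g x).
Proof.
move=> oV /msmoothCP[f1 f2] /msmoothCP[g1 g2]; apply/msmoothCP.
have re := msmoothB oV (msmoothM oV f1 g1) (msmoothM oV f2 g2).
have im := msmoothD oV (msmoothM oV f1 g2) (msmoothM oV f2 g1).
split; [apply: msmooth_eq re | apply: msmooth_eq im] => // x _;
by case: (f x) (g x) => [? ?] [? ?] //=; rewrite mulrC [in X in _ + X]mulrC.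
Qed.

End SmoothFunctions.

(** * Smooth maps and the chain rule *)

Section SmoothMaps.
Context {R : realType}.

Lemma smooth_map_open (m n : nat) (M : manifold R m) (N : manifold R n)
  (h : M -> N) (V : set N) : smooth_map h -> open V -> open (h @^-1` V).
Proof. by case=> ch _; apply: open_comp => x _; exact: ch. Qed.

Lemma smooth_mapC (m n : nat) (M : manifold R m) (N : manifold R n) (h : M -> N)
    (V : set N) (f : N -> complex R) : smooth_map h -> open V ->
  msmoothC V f -> msmoothC (h @^-1` V) (f \o h).
Proof.
move=> [_ sh] oV /msmoothCP[s1 s2]; apply/msmoothCP.
by split; [exact: sh s1 | exact: sh s2].
Qed.

Lemma smooth_map_id (n : nat) (M : manifold R n) : smooth_map (@id M).
Proof. by split=> // x; exact: cvg_id. Qed.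

Lemma smooth_map_comp (l m n : nat) (L : manifold R l) (M : manifold R m)
    (N : manifold R n) (k : M -> N) (h : L -> M) :
  smooth_map k -> smooth_map h -> smooth_map (k \o h).
Proof.
move=> sk [ch sh]; have [ck skf] := sk; split.
  by move=> x; apply: continuous_comp; [exact: ch | exact: ck].
by move=> V f oV sf; apply: (sh (k @^-1` V) (f \o k)) (skf _ _ oV sf);
  exact: smooth_map_open.
Qed.

(** The base point of the differential, a point read back from its chart, is
replaced by the point itself, so that all charts are those at x and h x. *)
Lemma mjacE (m n : nat) (M : manifold R m) (N : manifold R n) (h : M -> N) x :
  mjac h x = jacobian (cmap (chart_at (h x)) \o h \o cinv (chart_at x))
                      (cmap (chart_at x) x).
Proof.
have [_ _ cK _ _] := atlas_coord (chart_at_atlas x).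
by rewrite /mjac /plot_jac cK //; exact: chart_at_dom.
Qed.

Lemma smooth_map_differentiable (m n : nat) (M : manifold R m)
    (N : manifold R n) (h : M -> N) x : smooth_map h ->
  differentiable (cmap (chart_at (h x)) \o h \o cinv (chart_at x))
                 (cmap (chart_at x) x).
Proof.
move=> sh; apply: differentiable_rV => j; set d := chart_at (h x).
have od : open (cdom d) by have [] := atlas_coord (chart_at_atlas (h x)).
have := sh.2 _ _ od (msmooth_coord j (chart_at_atlas (h x))).
move=> /(_ _ (chart_at_atlas x) 1%N)[+ _]; apply.
by exists x => //; split; exact: chart_at_dom.
Qed.

(** Row vectors multiply Jacobians on the left, so the factors appear in the
order of travel.  Rows of the Jacobians are directional derivatives, which
depend only on germs: this is what allows the passage through the chart at
h x, which is only defined near that point. *)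
Lemma mjac_comp (l m n : nat) (L : manifold R l) (M : manifold R m)
    (N : manifold R n) (k : M -> N) (h : L -> M) x :
  smooth_map k -> smooth_map h ->
  mjac (k \o h) x = mjac h x *m mjac k (h x).
Proof.
move=> sk sh; apply/row_matrixP => i; rewrite !rowE mulmxA !mjacE.
have dkh := smooth_map_differentiable x (smooth_map_comp sk sh).
have dh := smooth_map_differentiable x sh.
have dk := smooth_map_differentiable (h x) sk.
have [_ _ cK _ _] := atlas_coord (chart_at_atlas x).
have [od _ dK _ _] := atlas_coord (chart_at_atlas (h x)).
have hx : (cmap (chart_at (h x)) \o h \o cinv (chart_at x))
            (cmap (chart_at x) x) = cmap (chart_at (h x)) (h x).
  by rewrite /= cK //; exact: chart_at_dom.
rewrite -hx in dk *.
rewrite -(deriveEjacobian _ dkh) -(deriveEjacobian _ dh).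
rewrite -(deriveEjacobian _ dk) (deriveE _ dh) (deriveE _ dk).
have /(congr1 (@^~ (delta_mx 0 i))) /= <- := diff_comp dh dk.
rewrite -(deriveE _ (differentiable_comp dh dk)).
apply: near_eq_derive.
have hd := smooth_map_open sh od.
apply: filterS (chart_at_nbhs hd (chart_at_dom (h x))) => v /= cv.
by rewrite /= dK.
Qed.

Lemma mjac_id (n : nat) (M : manifold R n) (x : M) : mjac id x = 1%:M.
Proof.
apply/row_matrixP => i; rewrite !rowE mulmx1 mjacE.
rewrite -deriveEjacobian; last first.
  exact: smooth_map_differentiable (smooth_map_id M).
rewrite -[RHS](@derive_id _ _ (cmap (chart_at x) x)).
apply: near_eq_derive.
have ac := chart_at_atlas x; have [_ _ cK _ _] := atlas_coord ac.
apply: filterS (chart_image_nbhs ac openT I (chart_at_dom x)) => _ [y [_ cy] <-] /=.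
by rewrite cK.
Qed.

End SmoothMaps.

(** * Direct images along homeomorphisms *)

(** A local preimage over V, found near k y, becomes a local preimage over the
open set k^-1(V), because h^-1(k^-1(V)) = V. *)
Lemma pushforward_exact (T T' : topologicalType) (h : T -> T') (k : T' -> T)
    (ch : continuous h) (F G H : presheaf T) (a : phom F G) (b : phom G H) :
  continuous k -> cancel h k -> cancel k h -> exact_at a b ->
  exact_at (pushforward_hom ch a) (pushforward_hom ch b).
Proof.
move=> ck hK kK [ba0 ab]; split=> [U s|U t tb0 y Uy]; first exact: ba0.
have Uky : oset (opens_preimage ch U) (k y) by rewrite /= kK.
have [V [VU [s [Vky asE]]]] := ab _ t tb0 (k y) Uky.
have VU' : opens_preimage ck V `<=` U by move=> x /VU /=; rewrite kK.
have sV : opens_preimage ch (opens_preimage ck V) `<=` V.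
  by move=> x /=; rewrite hK.
exists (opens_preimage ck V), VU', (pres sV s); split=> //=.
by rewrite phom_res asE; apply: pres_comp.
Qed.

(** * Transition functions *)

Section Cocycles.
Context {R : realType}.

(** The part of the notion of a bundle that does not involve the connection; it
passes to pullbacks and tensor products without any computation with
connection forms. *)
Definition smooth_cocycle (n r : nat) (M : manifold R n) (E : bundle M r) :=
  [/\ forall x, exists i : bI E, bdom i x,
      forall (i j : bI E) a b,
        msmoothC (bdom i `&` bdom j) (fun x => btr i j x a b),
      forall (i : bI E) x, bdom i x -> btr i i x = 1%:M &
      forall (i j k : bI E) x, bdom i x -> bdom j x -> bdom k x ->
        btr i k x = btr i j x *m btr j k x].

Lemma bundle_cocycle (n r : nat) (M : manifold R n) (E : bundle M r) :
  is_bundle E -> smooth_cocycle E.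
Proof. by case=> cov [sm _] id1 coc _; split. Qed.

Lemma bpull_cocycle (m n r : nat) (M : manifold R m) (N : manifold R n)
    (h : smap M N) (E : bundle N r) :
  smooth_cocycle E -> smooth_cocycle (bpull h E).
Proof.
case=> cov sm id1 coc; split=> [x|i j a b|i x ix|i j k x ix jx kx].
- exact: cov.
- by apply: (smooth_mapC (smapP h) _ (sm i j a b)); apply: openI; exact: bdom_open.
- exact: id1.
- exact: coc.
Qed.

Lemma btensor_cocycle (n r : nat) (M : manifold R n) (E : bundle M r)
    (L : bundle M 1) :
  smooth_cocycle E -> smooth_cocycle L -> smooth_cocycle (btensor E L).
Proof.
case=> covE smE idE cocE [covL smL idL cocL]; split.
- by move=> x; have [[i ix] [j jx]] := (covE x, covL x); exists (i, j).
- move=> [i i'] [j j'] a b /=.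
  have oI : open ((bdom i `&` bdom i') `&` (bdom j `&` bdom j')).
    by do !apply: openI; exact: bdom_open.
  have sE : msmoothC ((bdom i `&` bdom i') `&` (bdom j `&` bdom j'))
                     (fun x => btr i j x a b).
    by apply: msmoothC_sub (smE i j a b) => x [[? ?] [? ?]].
  have sL : msmoothC ((bdom i `&` bdom i') `&` (bdom j `&` bdom j'))
                     (fun x => btr i' j' x 0 0).
    by apply: msmoothC_sub (smL i' j' 0 0) => x [[? ?] [? ?]].
  by apply: msmoothC_eq (msmoothCM oI sL sE) => // x _; rewrite mxE.
- by move=> [i i'] x /= [ix ix']; rewrite idE // idL // mxE eqxx scale1r.
- move=> [i i'] [j j'] [k k'] x /= [ix ix'] [jx jx'] [kx kx'].
  rewrite (cocE i j k) // (cocL i' j' k') // mxE big_ord1.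
  by rewrite -scalemxAl -scalemxAr scalerA.
Qed.

End Cocycles.

(** * Smooth sections over a base with a left inverse *)

Section SmoothSections.
Context {R : realType} {n m r : nat} {Z : manifold R n} {Y : manifold R m}.
Local Notation C := (complex R).
Variables (E : bundle Z r) (q : smap Z Y) (k : Y -> Z).
Hypotheses (sk : smooth_map k) (qK : cancel q k).

(** When k o q = id, the chain rule gives Jac(q) Jac(k) = 1, so an E-valued
1-form c on Z is the pullback along q of Jac(k) c: the relative differentials
of q vanish. *)
Lemma left_inverse_relatively_flat (V : set Z) (s : raw_section E) :
  relatively_flat q V s.
Proof.
move=> i x _ _.
exists (fun l => \sum_j real_complex R (mjac k (q x) l j) *: covariant s i x j).
move=> j; have jac : mjac q x *m mjac k (q x) = 1%:M.
  rewrite -mjac_comp //; last exact: smapP.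
  by rewrite (_ : k \o q = id) ?mjac_id //; exact/funext.
have jacC j' : \sum_l real_complex R (mjac q x j l) *
    real_complex R (mjac k (q x) l j') = (j == j')%:R.
  under eq_bigr do rewrite -rmorphM.
  by rewrite -rmorph_sum; move/matrixP/(_ j j'): jac; rewrite !mxE => ->;
    rewrite rmorph_nat.
under eq_bigr do rewrite scaler_sumr.
rewrite exchange_big (bigD1 j) //= [X in _ + X]big1 => [|j' jj'].
  under eq_bigr do rewrite scalerA.
  by rewrite addr0 -scaler_suml jacC eqxx scale1r.
under eq_bigr do rewrite scalerA.
by rewrite -scaler_suml jacC eq_sym (negPf jj') scale0r.
Qed.

Lemma section_ker_pred (V : opens Z) (s : raw_section E) :
  is_section (oset V) s -> ker_pred q V s.
Proof. by move=> Ss; apply/asboolP; split=> //; exact: left_inverse_relatively_flat. Qed.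

Lemma ker_sec_section (V : opens Z) (s : ker_sec E q V) :
  is_section (oset V) (ker_val s).
Proof. by have /asboolP[] := ker_valP s. Qed.

Lemma ker_sec_ext (V : opens Z) (s t : ker_sec E q V) :
  (forall i x, oset V x -> bdom i x -> ker_val s i x = ker_val t i x) -> s = t.
Proof.
move=> st; apply: val_inj; apply/funext => i; apply/funext => x /=.
have [[Vx ix]|nVix] := pselect (oset V x /\ bdom i x); first exact: st.
by have [_ _ ->//] := ker_sec_section s; have [_ _ ->//] := ker_sec_section t.
Qed.

Lemma scale_ker_pred (V : opens Z) (a : Z -> C) (s : ker_sec E q V) :
  msmoothC (oset V) a -> ker_pred q V (fun i x => a x *: ker_val s i x).
Proof.
move=> sa; have [sm tr s0] := ker_sec_section s; apply: section_ker_pred; split.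
- move=> i b; have oVi : open (oset V `&` bdom i).
    by apply: openI; [exact: osetP | exact: bdom_open].
  have sa' := msmoothC_sub (@subIsetl _ _ (bdom i)) sa.
  by apply: msmoothC_eq (msmoothCM oVi sa' (sm i b)) => // x _; rewrite mxE.
- by move=> i j x Vx ix jx; rewrite (tr i j) // scalemxAr.
- by move=> i x nx; rewrite s0 // scaler0.
Qed.

(** The module structure asks for a total operation, although the product of a
section with a function is a smooth section only when the function is smooth;
the value 0 is taken for the other functions. *)
Definition scale_sec (V : opens Z) (a : Z -> C) (s : ker_sec E q V) :
    ker_sec E q V :=
  match pselect (msmoothC (oset V) a) with
  | left sa => KerSec (scale_ker_pred s sa)
  | right _ => 0
  end.

Lemma scale_secE (V : opens Z) (a : Z -> C) (s : ker_sec E q V) i x :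
  msmoothC (oset V) a -> ker_val (scale_sec a s) i x = a x *: ker_val s i x.
Proof. by move=> sa; rewrite /scale_sec; case: pselect. Qed.

Lemma ker_val_res (U V : opens Z) (h : V `<=` U) (s : ker_sec E q U) i x :
  oset V x -> ker_val (ker_res h s) i x = ker_val s i x.
Proof. by move=> Vx; rewrite /= /raw_res asboolT. Qed.

Lemma ker_valD (V : opens Z) (s t : ker_sec E q V) i x :
  ker_val (s + t) i x = ker_val s i x + ker_val t i x.
Proof. by []. Qed.

(** Functions that agree on V are smooth on V simultaneously, so that the choice
of the value 0 is made consistently. *)
Lemma scale_sec_ext (V : opens Z) a b (s : ker_sec E q V) :
  (forall x, oset V x -> a x = b x) -> scale_sec a s = scale_sec b s.
Proof.
move=> ab; rewrite /scale_sec; have oV := osetP V.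
have ba x : oset V x -> b x = a x by move=> /ab.
case: pselect => sa; case: pselect => sb //.
- by apply: ker_sec_ext => i x Vx _ /=; rewrite ab.
- by case: sb; exact: msmoothC_eq oV ab sa.
- by case: sa; exact: msmoothC_eq oV ba sb.
Qed.

Lemma scale_sec1 (V : opens Z) (s : ker_sec E q V) : scale_sec (fun=> 1) s = s.
Proof.
by apply: ker_sec_ext => i x _ _; rewrite scale_secE ?scale1r //;
  exact: msmoothC_cst.
Qed.

Lemma scale_secA (V : opens Z) a b (s : ker_sec E q V) :
  msmoothC (oset V) a -> msmoothC (oset V) b ->
  scale_sec (fun x => a x * b x) s = scale_sec a (scale_sec b s).
Proof.
move=> sa sb; apply: ker_sec_ext => i x _ _; rewrite !scale_secE ?scalerA //.
exact: msmoothCM (osetP V) sa sb.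
Qed.

Lemma scale_secDl (V : opens Z) a b (s : ker_sec E q V) :
  msmoothC (oset V) a -> msmoothC (oset V) b ->
  scale_sec (fun x => a x + b x) s = scale_sec a s + scale_sec b s.
Proof.
move=> sa sb; apply: ker_sec_ext => i x _ _.
rewrite ker_valD !scale_secE ?scalerDl //; exact: msmoothCD (osetP V) sa sb.
Qed.

Lemma scale_secDr (V : opens Z) a (s t : ker_sec E q V) :
  msmoothC (oset V) a ->
  scale_sec a (s + t) = scale_sec a s + scale_sec a t.
Proof.
by move=> sa; apply: ker_sec_ext => i x _ _;
  rewrite ker_valD !scale_secE // ker_valD scalerDr.
Qed.

Lemma scale_sec_res (U V : opens Z) (h : V `<=` U) a (s : ker_sec E q U) :
  msmoothC (oset U) a ->
  ker_res h (scale_sec a s) = scale_sec a (ker_res h s).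
Proof.
move=> sa; apply: ker_sec_ext => i x Vx _; rewrite ker_val_res // !scale_secE //.
  by rewrite ker_val_res.
exact: msmoothC_sub sa.
Qed.

End SmoothSections.

(** * The local frames of a line bundle *)

Section Frame.
Context {R : realType} {n m : nat} {Z : manifold R n} {Y : manifold R m}.
Local Notation C := (complex R).
Variables (E : bundle Z 1) (q : smap Z Y) (k : Y -> Z).
Hypotheses (sk : smooth_map k) (qK : cancel q k) (coE : smooth_cocycle E).
Variables (i : bI E) (V : opens Z) (Vi : oset V `<=` bdom i).

(** The section whose component in the i-th frame is 1; the cocycle relation
forces its other components to be the transition functions. *)
Definition raw_frame : raw_section E :=
  fun j x => if `[< oset V x /\ bdom j x >] then btr j i x else 0.

Lemma raw_frame_ker_pred : ker_pred q V raw_frame.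
Proof.
have fE j x : oset V x -> bdom j x -> raw_frame j x = btr j i x.
  by move=> Vx jx; rewrite /raw_frame asboolT.
have [_ sm _ coc] := coE.
apply: (section_ker_pred sk qK); split.
- move=> j a.
  have oVj : open (oset V `&` bdom j).
    by apply: openI; [exact: osetP | exact: bdom_open].
  have sV : oset V `&` bdom j `<=` bdom j `&` bdom i.
    by move=> x [Vx jx]; split=> //; exact: Vi.
  apply: msmoothC_eq (msmoothC_sub sV (sm j i a 0)) => // x [Vx jx].
  by rewrite fE.
- by move=> j j' x Vx jx j'x; rewrite !fE // (coc j j') //; exact: Vi.
- by move=> j x nx; rewrite /raw_frame asboolF.
Qed.

Definition frame_sec : ker_sec E q V := KerSec raw_frame_ker_pred.

Lemma frame_sec_at x : oset V x -> ker_val frame_sec i x = 1%:M.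
Proof.
have [_ _ id1 _] := coE; move=> Vx; rewrite /= /raw_frame asboolT ?id1 //.
  exact: Vi.
by split=> //; exact: Vi.
Qed.

(** The frame has i-th component 1, so both sides have the same i-th component;
by the cocycle relation this component determines a section over a subset of
the domain of i. *)
Lemma frame_sec_spans (W : opens Z) (h : W `<=` V) (s : ker_sec E q W) :
  s = scale_sec sk qK (fun x => ker_val s i x 0 0) (ker_res h frame_sec).
Proof.
have [sm tr _] := ker_sec_section s.
have Wi : oset W `<=` bdom i by move=> x /h; exact: Vi.
apply: ker_sec_ext => j x Wx jx; rewrite scale_secE; last first.
  by apply: msmoothC_sub (sm i 0) => y Wy; split=> //; exact: Wi.
rewrite ker_val_res // /= /raw_frame asboolT; last by split=> //; exact: h.
rewrite (tr j i) //; last exact: Wi.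
by rewrite [in LHS](mx11_scalar (ker_val s i x)) mul_mx_scalar.
Qed.

End Frame.

(** * The diffeomorphism between Z_S and the dual family *)

Section Lifts.
Context {R : realType}.

(** Continuity holds because t^-1(A) = s^-1(iota(A)) and iota is closed.  A smooth
function on M is near t b of the form e o iota with e smooth on N, and its
pullback by t is then e o s. *)
Lemma closed_embedding_lift (l m n : nat) (B : manifold R l) (M : manifold R m)
    (N : manifold R n) (iota : smap M N) (s : smap B N) (t : B -> M) :
  closed_embedding iota -> (forall b, iota (t b) = s b) -> smooth_map t.
Proof.
move=> [inj clo ext] ts; split.
  apply/continuous_closedP => A cA.
  rewrite (_ : t @^-1` A = s @^-1` (iota @` A)).
    by move/continuous_closedP: (smapP s).1; apply; exact: clo.
  apply/seteqP; split=> b /=; first by exists (t b).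
  by move=> [x Ax]; rewrite -ts => /inj <-.
move=> V f oV sf; apply: msmooth_local => b Vb.
have [U [e [[oU Ub] se _ ef]]] := ext V f oV sf _ Vb.
exists (s @^-1` U), (e \o s); split.
- exact: smooth_map_open (smapP s) oU.
- by rewrite /= -ts.
- by case: (smapP s) => _; apply.
- by move=> y Uy; rewrite /= -ts ef ?ts.
Qed.

(** A base change of a diffeomorphism is a diffeomorphism: the pair (t o b, id)
induces the inverse, and the uniqueness part of the universal property of P
identifies the composite P -> N -> P with the identity. *)
Lemma fibre_product_inverse (l m n k : nat) (P : manifold R l)
    (M : manifold R m) (N : manifold R n) (B : manifold R k)
    (p : P -> M) (q : P -> N) (a : M -> B) (b : N -> B) (t : B -> M) :
  fibre_product p q a b -> smooth_map b -> smooth_map t ->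
  cancel a t -> cancel t a ->
  exists h : N -> P, [/\ smooth_map h, cancel h q & cancel q h].
Proof.
move=> [sp sq pq univ] sb st aK tK.
have [|h [[sh ph qh] _]] :=
  univ _ _ (t \o b) id (smooth_map_comp st sb) (smooth_map_id N).
  by move=> y; rewrite /= tK.
exists h; split=> // z.
have [g [_ uniq]] := univ _ _ p q sp sq pq.
have gid : g = id by apply: uniq; split=> //; exact: smooth_map_id.
have ghq : g = h \o q.
  apply: uniq; split=> [|y|y] /=; first exact: smooth_map_comp.
  - by rewrite ph /= -pq aK.
  - by rewrite qh.
by rewrite -[RHS]/(id z) -gid ghq.
Qed.

End Lifts.

(** This is where S being the image of a section enters: the lift of s through
iota is inverse to f o iota, and Z_S -> X^ is the base change of f o iota. *)
Lemma support_dual_diffeo (R : realType) (g : nat) (F : torus_family R g)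
    (Q : cotangent_quotient F) (D : dual_family Q) (P : poincare_family D)
    (k : nat) (S : transform_support P k) (s : smap (fB F) (fX F)) :
  (forall b, fproj F (s b) = b) -> range (siota S) = range s ->
  exists h : dX D -> sZ S,
    [/\ smooth_map h, cancel h (skappa S \o sq S) & cancel (skappa S \o sq S) h].
Proof.
move=> fs imS.
have /choice[t ts] b : exists x, siota S x = s b.
  by have [x _ <-] : range (siota S) (s b); [rewrite imS; exists b | exists x].
have st := closed_embedding_lift (siotaP S) ts.
have [inj _ _] := siotaP S.
apply: (fibre_product_inverse (sZP S) (smapP (dproj D)) st) => [x|b] /=.
  apply: inj; rewrite ts.
  have [b _ <-] : range s (siota S x) by rewrite -imS; exists x.
  by rewrite fs.
by rewrite ts fs.
Qed.

(** * The module structure of the transform *)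

Section Module.
Context {R : realType} {g : nat} {F : torus_family R g}.
Context {Q : cotangent_quotient F} {D : dual_family Q} {P : poincare_family D}.
Context {k r : nat} (S : transform_support P k) (E : bundle (sS S) r).
Local Notation C := (complex R).
Variable (h : dX D -> sZ S).
Hypotheses (sh : smooth_map h) (hK : cancel (skappa S \o sq S) h).

Let jY : sY S -> sZ S := h \o skappa S.
Let jY_smooth : smooth_map jY := smooth_map_comp sh (smapP (skappa S)).
Let jYK : cancel (sq S) jY := hK.

Definition transform_act (V : opens (dX D)) (a : dX D -> C)
    (s : transform0 E V) : transform0 E V :=
  scale_sec jY_smooth jYK (a \o (skappa S \o sq S)) (s : ker_sec _ _ _).

Let comp_smooth (V : opens (dX D)) a : msmoothC V a ->
  msmoothC ((skappa S \o sq S) @^-1` V) (a \o (skappa S \o sq S)).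
Proof.
apply: (smooth_mapC _ (osetP V)).
by apply: smooth_map_comp; exact: smapP.
Qed.

Lemma transform_act_ext (V : opens (dX D)) a b (s : transform0 E V) :
  (forall x, oset V x -> a x = b x) -> transform_act a s = transform_act b s.
Proof. by move=> ab; apply: scale_sec_ext => x Vx; exact: ab. Qed.

Lemma transform_act1 (V : opens (dX D)) (s : transform0 E V) :
  transform_act (fun=> 1) s = s.
Proof. exact: scale_sec1. Qed.

Lemma transform_actA (V : opens (dX D)) a b (s : transform0 E V) :
  msmoothC V a -> msmoothC V b ->
  transform_act (fun x => a x * b x) s = transform_act a (transform_act b s).
Proof. by move=> /comp_smooth sa /comp_smooth sb; exact: scale_secA. Qed.

Lemma transform_actDl (V : opens (dX D)) a b (s : transform0 E V) :
  msmoothC V a -> msmoothC V b ->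
  transform_act (fun x => a x + b x) s = transform_act a s + transform_act b s.
Proof. by move=> /comp_smooth sa /comp_smooth sb; exact: scale_secDl. Qed.

Lemma transform_actDr (V : opens (dX D)) a (s t : transform0 E V) :
  msmoothC V a ->
  transform_act a (s + t) = transform_act a s + transform_act a t.
Proof. by move=> /comp_smooth sa; exact: scale_secDr. Qed.

Lemma transform_act_res (U V : opens (dX D)) (i : V `<=` U) a
    (s : transform0 E U) : msmoothC U a ->
  pres i (transform_act a s) = transform_act a (pres i s).
Proof. by move=> /comp_smooth sa; exact: scale_sec_res. Qed.

Definition transform_module : smooth_module (transform0 E) :=
  SmoothModule transform_act_ext transform_act1 transform_actA transform_actDl
    transform_actDr transform_act_res.

Lemma transform_module_multiplication : multiplication_action transform_module.
Proof.
by move=> V a s /comp_smooth sa i z Vz; rewrite /transform0_val /= scale_secE.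
Qed.

End Module.

Section LineBundle.
Context {R : realType} {g : nat} {F : torus_family R g}.
Context {Q : cotangent_quotient F} {D : dual_family Q} {P : poincare_family D}.
Context {k : nat} (S : transform_support P k) (L : bundle (sS S) 1).
Variable (h : dX D -> sZ S).
Hypotheses (sh : smooth_map h) (hK : cancel (skappa S \o sq S) h).
Hypotheses (Kh : cancel h (skappa S \o sq S)) (coL : smooth_cocycle L).

Lemma coupled_cocycle : smooth_cocycle (coupled_bundle L).
Proof.
apply: btensor_cocycle; apply: bpull_cocycle => //.
exact: bundle_cocycle (pP_bundle P).
Qed.

(** A frame of the coupled bundle near h x is a frame of the transform near x; the
coefficients, functions on Z_S, are read on X^ through h. *)
Lemma transform_locally_free :
  locally_free (transform_module L sh hK) 1.
Proof.
move=> x; have [cov _ _ _] := coupled_cocycle; have [i ix] := cov (h x).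
pose U := Opens (smooth_map_open sh (bdom_open i)).
pose preZ (V : opens (dX D)) := opens_preimage (@smap_continuous _ _ _ _ _ (sq S))
  (opens_preimage (@smap_continuous _ _ _ _ _ (skappa S)) V).
have Ui : oset (preZ U) `<=` bdom i by move=> z /=; rewrite [h _]hK.
pose f := frame_sec (smooth_map_comp sh (smapP (skappa S))) hK coupled_cocycle Ui.
exists U, (fun=> f : transform0 L U); split=> // V VU s.
(* The restrictions of the two presheaves are compared by conversion, so this
   inclusion has to be the one used by the direct images. *)
pose VUZ : preZ V `<=` preZ U :=
  opens_preimage_sub (ch := smap_continuous (h := sq S))
    (opens_preimage_sub (ch := smap_continuous (h := skappa S)) VU).
have hV y : oset V y -> oset (preZ V) (h y).
  by move=> Vy; have := Kh y; rewrite /preZ /= => ->.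
split.
- exists (fun _ y => transform0_val s i (h y) 0 0).
  have [sm _ _] := ker_sec_section (s : ker_sec (coupled_bundle L) (sq S) (preZ V)).
  have sa : msmoothC V (fun y => transform0_val s i (h y) 0 0).
    have oVi : open (oset (preZ V) `&` bdom i).
      by apply: openI; [exact: osetP | exact: bdom_open].
    apply: msmoothC_sub (smooth_mapC sh oVi (sm i 0)) => y Vy.
    by split; [exact: hV | exact: (VU y Vy)].
  split=> // ; rewrite big_ord1.
  rewrite [LHS](frame_sec_spans (smooth_map_comp sh (smapP (skappa S))) hK
    coupled_cocycle Ui VUZ s).
  apply: scale_sec_ext => z Vz /=.
  by rewrite [h _]hK.
- move=> a b sa sb; rewrite !big_ord1 => ab l y Vy; rewrite (ord1 l).
  have fy : transform0_val (pres VU (f : transform0 L U)) i (h y) 0 0 = 1.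
    apply: etrans (congr1 (fun u : 'cV_1 => u 0 0)
                          (ker_val_res VUZ f i (hV y Vy))) _.
    by rewrite frame_sec_at ?mxE //; exact/(VUZ)/hV.
  have := congr1 (fun t => transform0_val t i (h y) 0 0) ab.
  rewrite !(transform_module_multiplication sh hK) //; try exact: hV.
  by rewrite !mxE fy !mulr1 [skappa S _]Kh.
Qed.

End LineBundle.

Theorem proposition3p6 (R : realType) (g : nat) (F : torus_family R g)
    (Q : cotangent_quotient F) (D : dual_family Q) (P : poincare_family D)
    (S : transform_support P g) (s : smap (fB F) (fX F))
    (s_lagrangian : lagrangian_section s)
    (S_image : range (siota S) = range s)
    (L : bundle (sS S) 1)
    (L_bundle : is_bundle L) (L_flat : flat L) (L_unitary : unitary L) :
  WIT L 0 /\
  exists2 A : smooth_module (transform0 L),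
    multiplication_action A & locally_free A 1.
Proof.
have [h [sh Kh hK]] := support_dual_diffeo s_lagrangian.1 S_image.
split; last first.
  exists (transform_module L sh hK).
    exact: transform_module_multiplication.
  exact: transform_locally_free Kh (bundle_cocycle L_bundle).
move=> [|i] // _ I e d [_ _ _ ex].
(* kappa o q is onto X^, but that q inverts h o kappa also needs that q is onto
   its target. *)
have qK : cancel (h \o skappa S) (sq S).
  move=> y; have [z _ <-] : range (sq S) y by rewrite sq_surj.
  by congr (sq S _); exact: hK.
apply: (pushforward_exact (k := h \o skappa S)) (ex i) => //.
by have [] := smooth_map_comp sh (smapP (skappa S)).
Qed.
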